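(* Let $I\subset[0,+\infty)$ be an interval and let $\gamma:I\to\mathbb{R}^2$ be a bounded continuous self-contracted curve. Then $\gamma$ has finite length. More precisely, $$\mathrm{length}(\gamma)\le(8\pi+2)\,D(\gamma),$$ where $D(\gamma)$ is the distance between the endpoints of $\gamma$.
   Context: Throughout, $\mathrm{dist}$ is the Euclidean distance. A curve $\gamma:I\to\mathbb{R}^n$ defined on an interval $I$ of $[0,+\infty)$ is called self-contracted if for all $t_1\le t_2\le t_3$ in $I$ one has $\mathrm{dist}(\gamma(t_1),\gamma(t_3))\ge\mathrm{dist}(\gamma(t_2),\gamma(t_3))$. A curve is bounded if its image is a bounded set. The length of $\gamma$ is the supremum of $\sum_{i=1}^{k}\mathrm{dist}(\gamma(t_i),\gamma(t_{i+1}))$ over all finite subdivisions $t_1<\dots<t_{k+1}$ of $I$. The endpoints of a bounded self-contracted curve $\gamma$ are the limits of $\gamma(t)$ as $t\to\inf I$ and as $t\to\sup I$ (with $\sup I=+\infty$ allowed); these limits exist in $\mathbb{R}^n$ for every bounded self-contracted curve. *)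

(* Defs.v *)
From HB Require Import structures.
From mathcomp Require Import all_boot all_order all_algebra.
From mathcomp Require Import all_classical all_reals all_analysis.

Set Implicit Arguments.
Unset Strict Implicit.
Unset Printing Implicit Defensive.

Import Order.TTheory GRing.Theory Num.Theory.
Import numFieldNormedType.Exports.

Local Open Scope classical_set_scope.
Local Open Scope ring_scope.

(* The library norm on 'rV[R]_n is the sup norm, so the Euclidean distance is
   spelled out. Topological notions (continuity, limits) and boundedness do not
   depend on this choice and are the library ones. *)
Definition edist (R : realType) (n : nat) (x y : 'rV[R]_n) : R :=
  Num.sqrt (\sum_(i < n) (x ord0 i - y ord0 i) ^+ 2).

Definition self_contracted (R : realType) (n : nat) (I : set R)
    (g : R -> 'rV[R]_n) : Prop :=
  forall t1 t2 t3 : R, I t1 -> I t2 -> I t3 -> t1 <= t2 -> t2 <= t3 ->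
    edist (g t2) (g t3) <= edist (g t1) (g t3).

Definition subdivision (R : realType) (I : set R) (s : seq R) : Prop :=
  sorted <%R s /\ forall t, t \in s -> I t.

Definition polygonal_length (R : realType) (n : nat) (g : R -> 'rV[R]_n)
    (s : seq R) : R :=
  \sum_(0 <= i < (size s).-1) edist (g s`_i) (g s`_i.+1).

(* Subdivisions with fewer than two points are allowed; they contribute 0, so
   that the length of a curve on a one-point interval is 0 and not -oo. *)
Definition curve_length (R : realType) (n : nat) (I : set R)
    (g : R -> 'rV[R]_n) : \bar R :=
  ereal_sup [set (polygonal_length g s)%:E | s in subdivision I].

(* The filters "t --> inf I" and "t --> sup I" for t ranging over I, where
   I is bounded below and sup I may be +oo (the real [sup] is only meaningful
   on sets that are bounded above). When the infimum or supremum belongs to I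
   it is not removed, so a one-point interval is covered. *)
Definition to_inf (R : realType) (I : set R) : set_system R :=
  within I (nbhs (inf I)).

Definition to_sup (R : realType) (I : set R) : set_system R :=
  within I (if `[< has_ubound I >] then nbhs (sup I) else pinfty_nbhs R).

Definition endpoint_dist (R : realType) (n : nat) (I : set R)
    (g : R -> 'rV[R]_n) : R :=
  edist (lim (g @ to_inf I)) (lim (g @ to_sup I)).

(* Main.v *)
Require Import Defs.
From HB Require Import structures.
From mathcomp Require Import all_boot all_order all_algebra.
From mathcomp Require Import all_classical all_reals all_analysis.
From mathcomp Require Import ring lra.
Import Order.TTheory GRing.Theory Num.Theory.
Import numFieldNormedType.Exports.
Local Open Scope classical_set_scope.
Local Open Scope ring_scope.

(** The length of a self-contracted planar polygon is paid for by the decrease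
    of the size of its future, where size means the sum of the support
    functions of the future in eight directions d, the axes and the diagonals.

    Fix a vertex p, the next vertex q, and let K be the set of all later
    vertices, q included. Self-contraction says that no point of K is closer
    to p than to q, so K lies beyond the bisector of p and q; it also says that
    two points of K are seen from p under an angle that is not obtuse. So
    the directions d pointing away from K see p strictly further out than K:
    dropping p lowers the sum of the eight supports by at least
    (sqrt 2 / 4) |p - q|. This is [octagon_gain]; up to the symmetries of the
    square it is the inequality [octant_gain] about two vectors.

    Summing over the polygon, (sqrt 2 / 4) length is at most the sum of the
    eight initial supports measured from the last vertex. The first vertex is
    the furthest from the last one, so each of these supports is at most the
    distance D between the extreme vertices, and length <= 16 sqrt 2 D
    ([chain_length_le]). As the square inscribed in the unit circle gives
    2 sqrt 2 <= pi ([pi_ge_4cos45]), this is within (8 pi + 2) D.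

    For the curve, D is bounded because the image is, so all inscribed polygons
    have bounded length; a nearly longest one shows that the curve hardly moves
    near the two ends of its interval, whence the limits there exist by
    completeness. Extending any polygon by two points of the curve close to
    these limits replaces D by the distance between the endpoints. *)

(* Unqualified, this name is the extended distance of uniform spaces. *)
Local Notation edist := Defs.edist.

(** * The gain of one edge, for one octant of directions *)

(** Coordinates are centred at the current vertex: q is the next vertex, N its
    norm, and u, v are later points at which the supports in the directions
    -(1, 0) and -(s, s) are attained; A and B stand for the drops of these
    supports when the current vertex is removed. Because q lies between (1, 0)
    and (1, 1), one of the two drops is large unless v is below the axis and u
    above it. The angle from v to u is then at most right, so the lower v lies,
    the closer u is to the axis: what v loses on the diagonal, u gains there. *)
Lemma octant_gain (R : realFieldType) (s N q1 q2 u1 u2 v1 v2 A B : R) :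
  0 < s -> s ^+ 2 = 2^-1 -> 0 <= N -> N ^+ 2 = q1 ^+ 2 + q2 ^+ 2 ->
  0 <= q2 -> q2 <= q1 ->
  N ^+ 2 / 2 <= u1 * q1 + u2 * q2 -> N ^+ 2 / 2 <= v1 * q1 + v2 * q2 ->
  0 <= u1 * v1 + u2 * v2 ->
  0 <= A -> u1 <= A -> 0 <= B -> s * (v1 + v2) <= B ->
  s / 2 * N <= A + B.
Proof.
move=> s0 ss N0 NN q20 q21 hu hv huv A0 uA B0 vB.
have [->|Nn0] := eqVneq N 0.
  by rewrite mulr0 addr_ge0.
have {Nn0}N0 : 0 < N by rewrite lt_def Nn0.
have s1 : s <= 1 by nra.
have q1N : q1 <= N by nra.
have qsN : q1 + q2 <= 2 * s * N.
  rewrite -(@ler_pXn2r _ 2) ?nnegrE //; [nra|nra|].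
  by rewrite mulr_ge0 ?mulr_ge0 ?ltW.
have q10 : 0 < q1 by nra.
(* Above the axis, being past the bisector gives v1 + v2 >= N / 2. *)
have [v20|v20] := leP 0 v2.
  apply: (@le_trans _ _ (s * (v1 + v2))); last first.
    by apply: le_trans vB _; rewrite lerDr.
  rewrite -mulrA ler_pM2l //.
  have [v10|v10] := leP 0 v1.
    have : (v1 + v2) * q1 >= N ^+ 2 / 2 by nra.
    have : (v1 + v2) * N >= (v1 + v2) * q1 by nra.
    nra.
  have : (v1 + v2) * q2 >= N ^+ 2 / 2 by nra.
  have [v3|v3] := leP 0 (v1 + v2); first by nra.
  nra.
have v1q : N / 2 <= v1.
  have : v1 * q1 >= N ^+ 2 / 2 by nra.
  nra.
(* Below the axis, being past the bisector gives u1 >= N / 2. *)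
have [u20|u20] := leP u2 0.
  apply: (@le_trans _ _ u1); last first.
    by apply: le_trans uA _; rewrite lerDl.
  have : u1 * q1 >= N ^+ 2 / 2 by nra.
  nra.
have u10 : 0 < u1 by nra.
(* A steep v forces u below the diagonal, as the angle between them is at
   most right; u then advances enough along the axis alone. *)
have [v3|v3] := ltP (v1 + v2) 0.
  apply: (@le_trans _ _ u1); last first.
    by apply: le_trans uA _; rewrite lerDl.
  have u12 : u2 <= u1 by nra.
  have : u1 * (q1 + q2) >= N ^+ 2 / 2 by nra.
  have : u1 * (2 * s * N) >= u1 * (q1 + q2) by nra.
  move=> h1 h2.
  have h3 : N / 2 <= u1 * (2 * s) by nra.
  nra.
apply: (@le_trans _ _ (u1 + s * (v1 + v2))); last exact: lerD.
(* With -t the slope of v, the gains are at least N t / (2 s (1 + t)) for u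
   and s N (1 - t) / 2 for v; their sum is at least s N / 2 as t ^+ 2 <= t. *)
pose t := - v2 / v1.
have v10 : 0 < v1 by nra.
have v2E : v2 = - (t * v1) by rewrite /t; field; rewrite gt_eqF.
have t0 : 0 < t by rewrite /t divr_gt0 // oppr_gt0.
have t1 : t <= 1 by rewrite /t ler_pdivrMr // mul1r; lra.
have u1t : t * u2 <= u1.
  have : v1 * (u1 - t * u2) >= 0 by rewrite v2E in huv; nra.
  by rewrite pmulr_rge0 // subr_ge0.
have tq : t * q1 + q2 <= (1 + t) * s * N by nra.
have h1 : u1 * (t * q1 + q2) >= t * (N ^+ 2 / 2).
  have : t * u2 * q2 <= u1 * q2 by rewrite ler_wpM2r.
  have : t * (N ^+ 2 / 2) <= t * (u1 * q1 + u2 * q2) by rewrite ler_wpM2l // ltW.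
  lra.
have h2 : u1 * ((1 + t) * s) >= t * N / 2.
  have : u1 * (t * q1 + q2) <= u1 * ((1 + t) * s * N).
    by rewrite ler_wpM2l // ltW.
  move=> h2; rewrite -(ler_pM2r N0); lra.
have h3 : u1 * (1 + t) >= t * N * s.
  have -> : u1 * (1 + t) = 2 * s * (u1 * ((1 + t) * s)).
    by transitivity (2 * s ^+ 2 * (u1 * (1 + t))); [rewrite ss; field|ring].
  have : 0 <= 2 * s by lra.
  move=> /ler_wpM2l /(_ _ _ h2); lra.
have h4 : v1 + v2 >= N / 2 * (1 - t).
  have : N / 2 * (1 - t) <= v1 * (1 - t) by rewrite ler_wpM2r // subr_ge0.
  rewrite v2E; lra.
have h5 : s * (v1 + v2) >= s * (N / 2 * (1 - t)) by rewrite ler_wpM2l // ltW.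
suff : (s / 2 * N) * (1 + t) <= (u1 + s * (N / 2 * (1 - t))) * (1 + t).
  rewrite ler_pM2r; last by lra.
  by move=> h; lra.
have : 0 <= s * N * (t * (1 - t)).
  apply: mulr_ge0; first exact: mulr_ge0 (ltW s0) (ltW N0).
  by apply: mulr_ge0; [exact: ltW|rewrite subr_ge0].
lra.
Qed.

(** * The Euclidean plane *)

Section plane.
Variable R : realType.
Implicit Types (d : R * R) (p q x y z : 'rV[R]_2).

Lemma edist_nneg n (u v : 'rV[R]_n) : 0 <= edist u v.
Proof. exact: sqrtr_ge0. Qed.

Lemma edistxx n (u : 'rV[R]_n) : edist u u = 0.
Proof.
by rewrite /edist big1 ?sqrtr0 // => i _; rewrite subrr expr0n.
Qed.

Lemma edistC n (u v : 'rV[R]_n) : edist u v = edist v u.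
Proof.
by rewrite /edist; congr Num.sqrt; apply: eq_bigr => i _; rewrite -sqrrN opprB.
Qed.

Lemma sqr_edist x y :
  edist x y ^+ 2 = (x 0 0 - y 0 0) ^+ 2 + (x 0 1 - y 0 1) ^+ 2.
Proof.
rewrite sqr_sqrtr; last by apply: sumr_ge0 => i _; rewrite sqr_ge0.
by rewrite big_ord_recl big_ord1; congr (_ + (x _ _ - y _ _) ^+ 2); exact: val_inj.
Qed.

Lemma edist_le_add (x y z : 'rV[R]_2) : edist x z <= edist x y + edist y z.
Proof.
have A0 := edist_nneg _ x y; have B0 := edist_nneg _ y z.
have AE := sqr_edist x y; have BE := sqr_edist y z.
rewrite -(@ler_pXn2r _ 2) ?nnegrE ?addr_ge0 ?edist_nneg // sqr_edist.
set A := edist x y in A0 AE *; set B := edist y z in B0 BE *.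
set a := x 0 0 - y 0 0 in AE *; set b := x 0 1 - y 0 1 in AE *.
set c := y 0 0 - z 0 0 in BE *; set d := y 0 1 - z 0 1 in BE *.
have -> : x 0 0 - z 0 0 = a + c by rewrite /a /c; ring.
have -> : x 0 1 - z 0 1 = b + d by rewrite /b /d; ring.
have CS : a * c + b * d <= A * B.
  apply: le_trans (ler_norm _) _.
  rewrite -(@ler_pXn2r _ 2) ?nnegrE ?mulr_ge0 // real_normK ?num_real //.
  rewrite exprMn AE BE -subr_ge0.
  by apply: le_trans (sqr_ge0 (a * d - b * c)) _; lra.
by rewrite [leRHS]sqrrD AE BE -mulr_natl; lra.
Qed.

(** The topology of row vectors comes from the sup norm; this lemma and the next
    one compare its balls with the Euclidean ones, up to a factor. *)
Lemma ball_edist (x y : 'rV[R]_2) e : edist x y < e -> ball x e y.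
Proof.
move=> xye; have e0 : 0 < e := le_lt_trans (edist_nneg _ x y) xye.
have coord i : `|x 0 i - y 0 i| <= edist x y.
  rewrite -(@ler_pXn2r _ 2) ?nnegrE ?edist_nneg // real_normK ?num_real //.
  rewrite sqr_edist; have h0 := sqr_ge0 (x 0 0 - y 0 0).
  have h1 := sqr_ge0 (x 0 1 - y 0 1).
  case: (split_ordP (i : 'I_(1 + 1))) => j ->; rewrite ord1.
    rewrite (_ : lshift 1 0 = 0); first by rewrite lerDl.
    exact: val_inj.
  rewrite (_ : rshift 1 0 = 1); first by rewrite lerDr.
  exact: val_inj.
split=> // i j; rewrite ord1 -ball_normE /ball_ /=.
exact: le_lt_trans (coord j) xye.
Qed.

Lemma edist_ball (x y : 'rV[R]_2) e : ball x e y -> edist x y < 2 * e.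
Proof.
case=> e0 h; have := h 0 0; have := h 0 1.
rewrite -ball_normE /ball_ /= => h1 h2.
rewrite -(@ltr_pXn2r _ 2) ?nnegrE ?edist_nneg ?mulr_ge0 ?ltW // sqr_edist.
have sq (u : R) : `|u| < e -> u ^+ 2 < e ^+ 2.
  by move=> ue; rewrite -[u ^+ 2]real_normK ?num_real // ltr_pXn2r ?nnegrE ?(ltW e0).
have := sq _ h1; have := sq _ h2; have := sqr_ge0 e.
by lra.
Qed.

(** Squaring the hypothesis gives |x - p|^2 <= 2 <x - p, y - p>, so that y is
    beyond the bisector of p and x, and x and y are seen from p under an angle
    that is not obtuse. *)
Lemma closer_dot p x y : edist x y <= edist p y ->
  edist p x ^+ 2 / 2 <= (x 0 0 - p 0 0) * (y 0 0 - p 0 0)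
                      + (x 0 1 - p 0 1) * (y 0 1 - p 0 1).
Proof.
rewrite -(@ler_pXn2r _ 2) ?nnegrE ?edist_nneg // !sqr_edist.
by move=> h; lra.
Qed.

Definition proj d x : R := d.1 * x 0 0 + d.2 * x 0 1.

Lemma proj_le_edist d x y : d.1 ^+ 2 + d.2 ^+ 2 = 1 ->
  proj d x - proj d y <= edist x y.
Proof.
move=> d1; apply: le_trans (ler_norm _) _.
rewrite -(@ler_pXn2r _ 2) ?nnegrE ?edist_nneg // real_normK ?num_real //.
rewrite sqr_edist -[leRHS]mul1r -d1 /proj.
rewrite -subr_ge0.
by apply: le_trans (sqr_ge0 (d.1 * (x 0 1 - y 0 1) - d.2 * (x 0 0 - y 0 0))) _; lra.
Qed.

(** * Eight directions *)

Definition cos45 : R := Num.sqrt 2^-1.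

Lemma cos45_gt0 : 0 < cos45. Proof. by rewrite sqrtr_gt0 invr_gt0. Qed.

Lemma sqr_cos45 : cos45 ^+ 2 = 2^-1. Proof. by rewrite sqr_sqrtr // invr_ge0. Qed.

Definition octagon : seq (R * R) :=
  [:: (1, 0); (-1, 0); (0, 1); (0, -1);
      (cos45, cos45); (cos45, - cos45); (- cos45, cos45); (- cos45, - cos45)].

Lemma octagon_unit d : d \in octagon -> d.1 ^+ 2 + d.2 ^+ 2 = 1.
Proof.
have hs := sqr_cos45.
rewrite !inE => /or4P[/eqP-> /=|/eqP-> /=|/eqP-> /=|]; try ring.
move=> /orP[/eqP-> /=|]; first ring.
by move=> /or4P[] /eqP-> /=; rewrite ?sqrrN hs; field.
Qed.

(** Dropping p from {p} and later points, with supports in the direction d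
    attained at [x d], lowers the total support in proportion to the distance
    from p to the next point q. The terms are bounded below by two of the eight:
    the axis and the diagonal opposite to the octant of q - p. *)
Lemma octagon_gain p q (x : R * R -> 'rV[R]_2) :
  (forall d, edist q (x d) <= edist p (x d)) ->
  (forall d e, edist (x d) (x e) <= edist p (x e) \/
               edist (x e) (x d) <= edist p (x d)) ->
  cos45 / 2 * edist p q <=
    \sum_(d <- octagon) Num.max 0 (proj d p - proj d (x d)).
Proof.
move=> hq hx.
suff gain (F : R * R -> R) : (forall d, 0 <= F d) ->
    (forall d, proj d p - proj d (x d) <= F d) ->
    cos45 / 2 * edist p q <= \sum_(d <- octagon) F d.
  by apply: gain => d; rewrite le_max lexx ?orbT.
move=> F0 Fge.
have {}hq d : edist p q ^+ 2 / 2 <= (x d 0 0 - p 0 0) * (q 0 0 - p 0 0)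
                                  + (x d 0 1 - p 0 1) * (q 0 1 - p 0 1).
  by apply: le_trans (closer_dot _ _ _ (hq d)) _; rewrite ![_ * (x d _ _ - _)]mulrC.
have {}hx d e : 0 <= (x d 0 0 - p 0 0) * (x e 0 0 - p 0 0)
                      + (x d 0 1 - p 0 1) * (x e 0 1 - p 0 1).
  have nneg y : 0 <= edist p y ^+ 2 / 2 by rewrite divr_ge0 ?sqr_ge0.
  case: (hx d e) => h; first exact: le_trans (nneg _) (closer_dot _ _ _ h).
  by apply: le_trans (nneg (x e)) (le_trans (closer_dot _ _ _ h) _); lra.
have s0 := cos45_gt0; have ss := sqr_cos45; have N0 := edist_nneg _ p q.
have NE := sqr_edist p q.
set a := q 0 0 - p 0 0 in hq.
set b := q 0 1 - p 0 1 in hq.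
have {}NE : edist p q ^+ 2 = a ^+ 2 + b ^+ 2.
  by rewrite NE /a /b; congr (_ + _); rewrite -sqrrN opprB.
have {}F_ge d : - (d.1 * (x d 0 0 - p 0 0) + d.2 * (x d 0 1 - p 0 1)) <= F d.
  by apply: le_trans (Fge d); rewrite /proj; lra.
move: (edist p q) => N in hq N0 NE *.
rewrite !big_cons big_nil.
(* The signs i, j reflect q - p into the first quadrant, where it lies below
   the diagonal; gain_y treats the octant above the diagonal by exchanging the
   coordinates. *)
have gain_x (i j : R) : i ^+ 2 = 1 -> j ^+ 2 = 1 -> 0 <= j * b ->
    j * b <= i * a -> cos45 / 2 * N <= F (- i, 0) + F (- i * cos45, - j * cos45).
  move=> i1 j1 jb ia; set d := (- i, 0); set e := (- i * cos45, - j * cos45).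
  apply: (@octant_gain _ cos45 N (i * a) (j * b)
    (i * (x d 0 0 - p 0 0)) (j * (x d 0 1 - p 0 1))
    (i * (x e 0 0 - p 0 0)) (j * (x e 0 1 - p 0 1))) => //.
  - by rewrite !exprMn i1 j1 !mul1r.
  - rewrite mulrACA [X in _ + X]mulrACA -!expr2 i1 j1 !mul1r; exact: hq.
  - rewrite mulrACA [X in _ + X]mulrACA -!expr2 i1 j1 !mul1r; exact: hq.
  - rewrite mulrACA [X in _ + X]mulrACA -!expr2 i1 j1 !mul1r; exact: hx.
  - by apply: le_trans (F_ge d); rewrite /=; lra.
  - by apply: le_trans (F_ge e); rewrite /=; lra.
have gain_y (i j : R) : i ^+ 2 = 1 -> j ^+ 2 = 1 -> 0 <= i * a ->
    i * a <= j * b -> cos45 / 2 * N <= F (0, - j) + F (- i * cos45, - j * cos45).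
  move=> i1 j1 ia jb; set d := (0, - j); set e := (- i * cos45, - j * cos45).
  apply: (@octant_gain _ cos45 N (j * b) (i * a)
    (j * (x d 0 1 - p 0 1)) (i * (x d 0 0 - p 0 0))
    (j * (x e 0 1 - p 0 1)) (i * (x e 0 0 - p 0 0))) => //.
  - by rewrite !exprMn i1 j1 !mul1r addrC.
  - rewrite mulrACA [X in _ + X]mulrACA -!expr2 i1 j1 !mul1r [leRHS]addrC; exact: hq.
  - rewrite mulrACA [X in _ + X]mulrACA -!expr2 i1 j1 !mul1r [leRHS]addrC; exact: hq.
  - rewrite mulrACA [X in _ + X]mulrACA -!expr2 i1 j1 !mul1r [leRHS]addrC; exact: hx.
  - by apply: le_trans (F_ge d); rewrite /=; lra.
  - by apply: le_trans (F_ge e); rewrite /=; lra.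
have sgn1 : (1 : R) ^+ 2 = 1 by rewrite expr1n.
have sgnN1 : (-1 : R) ^+ 2 = 1 by rewrite sqrrN expr1n.
have := (gain_x 1 1 sgn1 sgn1, gain_x 1 (-1) sgn1 sgnN1,
  gain_x (-1) 1 sgnN1 sgn1, gain_x (-1) (-1) sgnN1 sgnN1,
  (gain_y 1 1 sgn1 sgn1, gain_y 1 (-1) sgn1 sgnN1,
  gain_y (-1) 1 sgnN1 sgn1, gain_y (-1) (-1) sgnN1 sgnN1)).
rewrite !opprK !mulN1r !mul1r.
move: (F0 (1, 0)) (F0 (-1, 0)) (F0 (0, 1)) (F0 (0, -1)) (F0 (cos45, cos45))
  (F0 (cos45, - cos45)) (F0 (- cos45, cos45)) (F0 (- cos45, - cos45)).
clear=> ? ? ? ? ? ? ? ? [[[[x1 x2] x3] x4] [[[y1 y2] y3] y4]].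
have [a0|/ltW a0] := leP 0 a; have [b0|/ltW b0] := leP 0 b.
- by have [ab|/ltW ab] := leP b a; [move: (x1 b0 ab)|move: (y1 a0 ab)]; lra.
- have nb : 0 <= - b by rewrite oppr_ge0.
  by have [ab|/ltW ab] := leP (- b) a; [move: (x2 nb ab)|move: (y2 a0 ab)]; lra.
- have na : 0 <= - a by rewrite oppr_ge0.
  by have [ab|/ltW ab] := leP b (- a); [move: (x3 b0 ab)|move: (y3 na ab)]; lra.
- have na : 0 <= - a by rewrite oppr_ge0.
  have nb : 0 <= - b by rewrite oppr_ge0.
  by have [ab|/ltW ab] := leP (- b) (- a);
    [move: (x4 nb ab)|move: (y4 na ab)]; lra.
Qed.

(** Half a side of the square inscribed in the unit circle is shorter than the
    arc of length pi / 4 cut off beside it: sin x <= x at x = pi / 4. *)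
Lemma pi_ge_4cos45 : 4 * cos45 <= pi.
Proof.
set x : R := pi / 4.
have x0 : 0 < x by rewrite divr_gt0 ?pi_gt0.
have sx : sin x = cos45.
  have := @tan_piquarter R; rewrite -/x /tan => h.
  have c0 : cos x != 0.
    apply/eqP => c0; move: h; rewrite c0 invr0 mulr0.
    by move/eqP; rewrite eq_sym oner_eq0.
  have sc : sin x = cos x by rewrite -[LHS](divfK c0) h mul1r.
  have s0 : 0 <= sin x.
    by apply: sin_ge0_pi; rewrite ltW //= /x; have := pi_gt0 R; lra.
  apply/eqP; rewrite -(@eqrXn2 _ 2) ?(ltW cos45_gt0) // sqr_cos45.
  have := cos2Dsin2 x; rewrite -sc => h1; apply/eqP; lra.
have csin : {within `[0, x], continuous (@sin R)}.
  by apply: continuous_subspaceT => c; exact: continuous_sin.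
have [c _] := MVT x0 (fun c _ => is_derive_sin c) csin.
rewrite sin0 !subr0 sx => ->.
have : cos c * x <= 1 * x by rewrite ler_wpM2r ?cos_le1 // ltW.
rewrite /x; lra.
Qed.

(** * Self-contracted polygons *)

Implicit Types (I : set R) (g : R -> 'rV[R]_2) (t u : R) (s : seq R).

Lemma polygonal_length_cons2 n (f : R -> 'rV[R]_n) t t' s :
  polygonal_length f [:: t, t' & s] =
    edist (f t) (f t') + polygonal_length f (t' :: s).
Proof. by rewrite /polygonal_length /= big_nat_recl. Qed.

Lemma polygonal_length_rcons g t s u :
  polygonal_length g (rcons (t :: s) u) =
    polygonal_length g (t :: s) + edist (g (last t s)) (g u).
Proof.
elim: s t => [|t' s IH] t /=.
  rewrite polygonal_length_cons2 addrC; congr (_ + _).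
  by rewrite /polygonal_length !big_geq.
by rewrite !polygonal_length_cons2 -addrA; congr (_ + _); exact: IH.
Qed.

Lemma polygonal_length_ge0 g s : 0 <= polygonal_length g s.
Proof. by apply: sumr_ge0 => i _; exact: edist_nneg. Qed.

(** Repeated times are allowed, unlike in subdivisions, so that a polygon can be
    extended by an endpoint that is already one of its vertices. *)
Definition chain I s := sorted <=%R s /\ forall t, t \in s -> I t.

Lemma chain_rcons I t s u : chain I (t :: s) -> I u -> last t s <= u ->
  chain I (rcons (t :: s) u).
Proof.
move=> [/= sP sI] Iu le; split=> [|t1]; first by rewrite /= rcons_path sP.
by rewrite -rcons_cons mem_rcons in_cons => /predU1P[->|/sI].
Qed.

Lemma chain_cons I t s u : chain I (t :: s) -> I u -> u <= t -> chain I [:: u, t & s].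
Proof.
move=> [/= sP sI] Iu le; split=> [|t1]; first by rewrite /= le.
by rewrite in_cons => /predU1P[->|/sI].
Qed.

(** The support function in the direction d of the future of time t along the
    polygon; passing t apart from s keeps the list nonempty, so that the maximum
    is attained. *)
Fixpoint support g d t s : R :=
  if s is t' :: s' then Num.max (proj d (g t)) (support g d t' s')
  else proj d (g t).

Lemma support_attained g d t s :
  exists2 t', t' \in t :: s & support g d t s = proj d (g t').
Proof.
elim: s t => [|t' s IH] t /=; first by exists t => //; rewrite mem_head.
have [t1 t1s ->] := IH t'; case: leP => _.
  by exists t1 => //; rewrite in_cons t1s orbT.
by exists t => //; rewrite mem_head.
Qed.

(** The total support drops by [octagon_gain] at each vertex, and at the last
    vertex it is zero relative to that vertex. *)
Lemma polygonal_length_support I g t s : self_contracted I g -> chain I (t :: s) ->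
  cos45 / 2 * polygonal_length g (t :: s) <=
    \sum_(d <- octagon) (support g d t s - proj d (g (last t s))).
Proof.
move=> sc; elim: s t => [|t' s IH] t.
  by rewrite /polygonal_length big_geq // mulr0 big1_seq // => d _; rewrite subrr.
move=> [/[dup] tP /= /andP[tt' t's] inI].
have memI t1 : t1 \in t' :: s -> I t1.
  by move=> h; apply: inI; rewrite in_cons h orbT.
have {}IH := IH _ (conj t's memI).
have /choice[tau tauP] d : exists t1, t1 \in t' :: s /\
    support g d t' s = proj d (g t1).
  by have [t1] := support_attained g d t' s; exists t1.
have tmin t1 : t1 \in t' :: s -> t <= t1.
  exact: (allP (order_path_min le_trans tP)).
have t'min t1 : t1 \in t' :: s -> t' <= t1.
  rewrite inE => /predU1P[->//|].
  exact: (allP (order_path_min le_trans t's)).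
have It : I t by apply: inI; rewrite mem_head.
have gain : cos45 / 2 * edist (g t) (g t') <=
    \sum_(d <- octagon) Num.max 0 (proj d (g t) - proj d (g (tau d))).
  apply: (octagon_gain (g t) (g t') (fun d => g (tau d))) => [d|d e].
    have [h _] := tauP d.
    by apply: sc => //; [apply: memI; rewrite mem_head|exact: memI|exact: t'min].
  have [hd _] := tauP d; have [he _] := tauP e.
  by have [|/ltW] := leP (tau d) (tau e); [left|right]; apply: sc => //;
    by [exact: memI|exact: tmin].
rewrite polygonal_length_cons2 mulrDr.
apply: le_trans (lerD gain IH) _; rewrite -big_split /=.
apply: ler_sum => d _; have [_ <-] := tauP d; rewrite addrA lerD2r.
by rewrite addr_maxl add0r subrK maxC.
Qed.

(** Each of the eight supports starts at most at the distance of the extreme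
    vertices, and 8 / (cos45 / 2) = 32 cos45 since cos45 ^+ 2 = 1 / 2. *)
Lemma chain_length_le I g t s : self_contracted I g -> chain I (t :: s) ->
  polygonal_length g (t :: s) <= 32 * cos45 * edist (g t) (g (last t s)).
Proof.
move=> sc [/= tP inI].
have tmin t1 : t1 \in t :: s -> t <= t1.
  rewrite inE => /predU1P[->//|].
  exact: (allP (order_path_min le_trans tP)).
have lmax t1 : t1 \in t :: s -> t1 <= last t s.
  move: tP; clear.
  elim: s t t1 => [|t' s IH] t t1 /=; first by rewrite inE => _ /eqP->.
  move=> /andP[tt' t's]; rewrite inE => /predU1P[->|]; last exact: IH.
  by apply: le_trans tt' (IH _ _ t's _); rewrite mem_head.
have h : cos45 / 2 * polygonal_length g (t :: s) <= 8 * edist (g t) (g (last t s)).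
  apply: le_trans (polygonal_length_support I g t s sc (conj tP inI)) _.
  rewrite (_ : 8 * _ = \sum_(d <- octagon) edist (g t) (g (last t s))); last first.
    by rewrite !big_cons big_nil; ring.
  rewrite big_seq [leRHS]big_seq; apply: ler_sum => d dO.
  have [t1 t1s ->] := support_attained g d t s.
  apply: le_trans (proj_le_edist _ _ _ (octagon_unit _ dO)) _.
  (* The first vertex is the furthest one from the last vertex. *)
  apply: sc; [| exact: inI| | exact: tmin|exact: lmax].
    by apply: inI; rewrite mem_head.
  by apply: inI; rewrite mem_last.
have := sqr_cos45; have := cos45_gt0.
set L := polygonal_length _ _ in h *; set D := edist _ _ in h *.
move=> s0 ss.
have -> : L = 4 * cos45 * (cos45 / 2 * L).
  by transitivity (2 * cos45 ^+ 2 * L); [rewrite ss; field|field].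
have : 0 <= 4 * cos45 by lra.
move=> /ler_wpM2l /(_ _ _ h) /le_trans; apply; lra.
Qed.

(** * The two ends of the curve *)

Lemma cvg_limit_approx (F : set_system R) (g : R -> 'rV[R]_2) (A : set R) e :
  ProperFilter F -> cvg (g @ F) -> F A -> 0 < e ->
  exists2 t, A t & edist (g t) (lim (g @ F)) < e.
Proof.
move=> FF gF FA e0.
have e20 : 0 < e / 2 by rewrite divr_gt0.
have gB : F (g @^-1` ball (lim (g @ F)) (e / 2)).
  exact: gF _ (nbhsx_ballx _ _ e20).
have /filter_ex[t [At gt]] : F (A `&` g @^-1` ball (lim (g @ F)) (e / 2)).
  exact: filterI.
exists t => //; rewrite edistC; have := edist_ball _ _ _ gt.
by rewrite mulrC divfK.
Qed.

Lemma cvg_of_small_tails (F : set_system R) (g : R -> 'rV[R]_2) :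
  ProperFilter F ->
  (forall e, 0 < e -> exists t0, F [set t | edist (g t0) (g t) < e]) ->
  cvg (g @ F).
Proof.
move=> FF small; apply/cauchy_cvgP/cauchy_exP => e e0.
have [t0 Ft0] := small e e0; exists (g t0).
change (F (g @^-1` ball (g t0) e)).
by apply: filterS Ft0 => t; exact: ball_edist.
Qed.

Section curve.
Variables (I : set R) (g : R -> 'rV[R]_2).

Lemma bounded_edist : bounded_set (g @` I) ->
  exists M, forall t u, I t -> I u -> edist (g t) (g u) <= M.
Proof.
case=> M [_ /(_ (M + 1))]; rewrite ltrDl ltr01 => /(_ isT) bM.
exists (2 * (2 * (M + 1) + 1)) => t u It Iu.
apply/ltW/edist_ball; rewrite mx_norm_ball /ball_ /=.
have bt : `|g t| <= M + 1 by apply: bM; exists t.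
have bu : `|g u| <= M + 1 by apply: bM; exists u.
by apply: le_lt_trans (ler_normB _ _) _; lra.
Qed.

Hypothesis sc : self_contracted I g.
Hypothesis gb : bounded_set (g @` I).
Variable t0 : R.
Hypothesis It0 : I t0.

Lemma near_optimal_chain e : 0 < e -> exists t s, chain I (t :: s) /\
  forall s', chain I s' -> polygonal_length g s' < polygonal_length g (t :: s) + e.
Proof.
move=> e0; have [M bM] := bounded_edist gb.
pose L := [set polygonal_length g (p.1 :: p.2) |
  p in [set p : R * seq R | chain I (p.1 :: p.2)]].
have c0 : chain I [:: t0].
  by split=> // t; rewrite inE => /eqP ->.
have ubL : has_ubound L.
  exists (32 * cos45 * M) => _ [[t s] /= c <-].
  apply: le_trans (chain_length_le _ _ _ _ sc c) _; rewrite ler_wpM2l //.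
    by rewrite mulr_ge0 // ltW // cos45_gt0.
  by apply: bM; apply: (proj2 c); rewrite ?mem_head ?mem_last.
have supL : has_sup L by split=> //; exists (polygonal_length g [:: t0]), (t0, [::]).
have [_ [[t s] /= c <-] Lt] := sup_adherent e0 supL.
exists t, s; split=> // -[|t' s'] c'.
  by rewrite {1}/polygonal_length big_geq // ltr_wpDl // polygonal_length_ge0.
have : polygonal_length g (t' :: s') <= sup L.
  by apply: ub_le_sup => //; exists (t', s').
by lra.
Qed.

(** Any detour after the end of a nearly longest polygon, and likewise before its
    start, would lengthen it too much. *)
Lemma small_tails e : 0 < e ->
  exists T, I T /\ forall t, I t -> T <= t -> edist (g T) (g t) < e.
Proof.
move=> /near_optimal_chain[t [s [c h]]].
have IT : I (last t s) by apply: (proj2 c); rewrite mem_last.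
exists (last t s); split=> // u Iu le.
have := h _ (chain_rcons _ _ _ _ c Iu le); rewrite polygonal_length_rcons.
by rewrite ltrD2l.
Qed.

Lemma small_heads e : 0 < e ->
  exists T, I T /\ forall t, I t -> t <= T -> edist (g T) (g t) < e.
Proof.
move=> /near_optimal_chain[t [s [c h]]].
have IT : I t by apply: (proj2 c); rewrite mem_head.
exists t; split=> // u Iu le.
have := h _ (chain_cons _ _ _ _ c Iu le); rewrite polygonal_length_cons2.
by rewrite addrC ltrD2l edistC.
Qed.

Lemma to_sup_proper : ProperFilter (to_sup I).
Proof.
rewrite /to_sup; case: asboolP => ubI; apply: Build_ProperFilter_ex.
- move=> P [e /= e0 he].
  have [t It st] := sup_adherent e0 (conj (ex_intro _ _ It0) ubI).
  exists t; apply: he => //=; have := ub_le_sup ubI It => ts.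
  by rewrite /ball_ /= ger0_norm ?subr_ge0 //; lra.
- move=> P [M [_ hM]]; apply: contrapT => h; apply: ubI; exists M => t It.
  by rewrite leNgt; apply/negP => Mt; apply: h; exists t; exact: hM.
Qed.

Lemma to_inf_proper : has_lbound I -> ProperFilter (to_inf I).
Proof.
move=> lbI; rewrite /to_inf; apply: Build_ProperFilter_ex.
move=> P [e /= e0 he].
have [t It st] := inf_adherent e0 (conj (ex_intro _ _ It0) lbI).
exists t; apply: he => //=; have := ge_inf lbI It => ts.
by rewrite /ball_ /= distrC ger0_norm ?subr_ge0 //; lra.
Qed.

(** Outside the excluded case the end is not attained, hence is strictly beyond
    every time of the curve. *)
Lemma to_sup_tail T : ~ (has_ubound I /\ I (sup I)) -> I T ->
  to_sup I [set t | I t /\ T <= t].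
Proof.
rewrite /to_sup; case: asboolP => ubI supI IT.
- have Tsup : T < sup I.
    rewrite lt_neqAle ub_le_sup // andbT; apply/eqP => TE.
    by apply: supI; split=> //; rewrite -TE.
  by apply: filterS (lt_nbhsr Tsup) => t Tt It; split=> //; exact: ltW.
- by apply: filterS (nbhs_pinfty_ge (num_real T)) => t Tt It; split.
Qed.

Lemma to_inf_head T : has_lbound I -> ~ I (inf I) -> I T ->
  to_inf I [set t | I t /\ t <= T].
Proof.
move=> lbI infI IT.
have Tinf : inf I < T.
  rewrite lt_neqAle ge_inf // andbT; apply/eqP => TE.
  by apply: infI; rewrite TE.
by apply: filterS (lt_nbhsl Tinf) => t tT It; split=> //; exact: ltW.
Qed.

Hypothesis gc : {within I, continuous g}.

(** The relation r orders time towards the end described by the filter F, which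
    serves both ends at once. An end that belongs to the interval is reached by
    continuity; at any other end the limit exists by completeness. *)
Lemma end_approx (F : set_system R) (r : R -> R -> Prop) : ProperFilter F ->
  (exists c, [/\ I c, F = within I (nbhs c) & forall t, I t -> r t c]) \/
  (forall T, I T -> F [set t | I t /\ r T t]) ->
  (forall e, 0 < e ->
    exists T, I T /\ forall t, I t -> r T t -> edist (g T) (g t) < e) ->
  forall e t1, 0 < e -> I t1 ->
  exists t, [/\ I t, r t1 t & edist (g t) (lim (g @ F)) < e].
Proof.
move=> FF [[c [Ic FE rc]]|tails] small e t1 e0 It1.
  have gF : g @ F --> g c by rewrite FE; move/subspace_continuousP: gc; exact.
  exists c; split=> //; first exact: rc.
  by rewrite (cvg_lim _ gF) ?edistxx //; exact: norm_hausdorff.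
have gF : cvg (g @ F).
  apply: cvg_of_small_tails => e' /small[T [IT hT]]; exists T.
  by apply: filterS (tails _ IT) => t [It rt]; exact: hT.
have [t [It rt] gt] := cvg_limit_approx F g _ e FF gF (tails _ It1) e0.
by exists t.
Qed.

Lemma sup_end_approx e t1 : 0 < e -> I t1 ->
  exists t, [/\ I t, t1 <= t & edist (g t) (lim (g @ to_sup I)) < e].
Proof.
apply: (end_approx (to_sup I) (fun t u => t <= u));
  [exact: to_sup_proper| |exact: small_tails].
have [[ubI Is]|h] := pselect (has_ubound I /\ I (sup I)).
  left; exists (sup I); split=> //; last by move=> t; exact: ub_le_sup.
  by rewrite /to_sup asboolT.
by right=> T; exact: to_sup_tail.
Qed.

Lemma inf_end_approx e t1 : has_lbound I -> 0 < e -> I t1 ->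
  exists t, [/\ I t, t <= t1 & edist (g t) (lim (g @ to_inf I)) < e].
Proof.
move=> lbI; apply: (end_approx (to_inf I) (fun t u => u <= t));
  [exact: to_inf_proper| |exact: small_heads].
have [Ii|h] := pselect (I (inf I)).
  by left; exists (inf I); split=> // t; exact: ge_inf.
by right=> T; exact: to_inf_head.
Qed.

(** Extending the polygon by curve points within eps of the two limits costs at
    most 2 eps in the distance between its extreme vertices. *)
Lemma chain_length_endpoint t s : has_lbound I -> chain I (t :: s) ->
  polygonal_length g (t :: s) <= 32 * cos45 * endpoint_dist I g.
Proof.
move=> lbI c; apply/ler_addgt0Pr => e e0.
have k0 : 0 < 32 * cos45 :> R by rewrite mulr_gt0 ?cos45_gt0.
pose eps := e / (2 * (32 * cos45)).
have eps0 : 0 < eps by apply: divr_gt0 => //; exact: mulr_gt0.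
have It : I t by apply: (proj2 c); rewrite mem_head.
have Il : I (last t s) by apply: (proj2 c); rewrite mem_last.
have [u [Iu ut ua]] := inf_end_approx _ _ lbI eps0 It.
have [v [Iv tv vb]] := sup_end_approx _ _ eps0 Il.
have c2 := chain_rcons _ _ _ _ (chain_cons _ _ _ _ c Iu ut) Iv tv.
have : polygonal_length g (rcons [:: u, t & s] v) <= 32 * cos45 * edist (g u) (g v).
  by have := chain_length_le _ _ u (rcons (t :: s) v) sc c2; rewrite last_rcons.
rewrite polygonal_length_rcons polygonal_length_cons2 => h.
apply: (@le_trans _ _ (32 * cos45 * edist (g u) (g v))).
  apply: le_trans h; rewrite -addrA addrCA lerDl addr_ge0 //; exact: edist_nneg.
rewrite /endpoint_dist; set a := lim _ in ua *; set b := lim _ in vb *.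
have : edist (g u) (g v) <= edist a b + 2 * eps.
  have := edist_le_add (g u) a (g v); have := edist_le_add a b (g v).
  by rewrite [edist b _]edistC; lra.
rewrite -(ler_pM2l k0) => /le_trans; apply.
rewrite mulrDr lerD2l /eps.
rewrite le_eqVlt; apply/orP; left; apply/eqP; field; rewrite gt_eqF //.
exact: cos45_gt0.
Qed.

End curve.

End plane.

(** * The length estimate *)

Theorem theorem1p3 (R : realType) (I : set R) (g : R -> 'rV[R]_2)
  (I_interval : is_interval I)
  (I_nneg : I `<=` [set t : R | 0 <= t])
  (g_bounded : bounded_set (g @` I))
  (g_continuous : {within I, continuous g})
  (g_self_contracted : self_contracted I g) :
  (curve_length I g < +oo)%E /\
  (curve_length I g <= ((8 * pi + 2) * endpoint_dist I g)%:E)%E.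
Proof.
suff le : (curve_length I g <= ((8 * pi + 2) * endpoint_dist I g)%:E)%E.
  by split=> //; apply: le_lt_trans le _; exact: ltry.
have k0 : 0 <= 8 * pi + 2 :> R by have := pi_ge0 R; lra.
(* The empty subdivision, the only one if I is empty, has no vertex from which
   to extend a polygon to the endpoints. *)
apply: ge_ereal_sup => _ [[|t s] [sP sI] <-]; rewrite lee_fin.
  rewrite /polygonal_length big_geq // mulr_ge0 //; exact: edist_nneg.
have c : chain R I (t :: s) by split=> //; apply: (sub_sorted _ sP) => u v; exact: ltW.
have lbI : has_lbound I by exists 0 => u /I_nneg.
have It : I t by apply: sI; rewrite mem_head.
apply: le_trans (chain_length_endpoint _ _ _ g_self_contracted g_bounded _ It
  g_continuous _ _ lbI c) _.
rewrite ler_wpM2r ?edist_nneg //.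
by have := pi_ge_4cos45 R; have := cos45_gt0 R; lra.
Qed.
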